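(* There is no rational function $R$ whose Newton map $N_R(z)=z-\frac{R(z)}{R'(z)}$ is conformally conjugate to a polynomial of the form $a(z-\alpha)^{\sigma}+b$ with $a,\alpha,b\in\mathbb{C}$, $a\neq 0$, and $\sigma\geq 3$ an integer.
   Context: Two rational functions $f_1,f_2$ (viewed as self-maps of the extended complex plane $\widehat{\mathbb{C}}$) are conformally conjugate if $f_1=\phi\circ f_2\circ\phi^{-1}$ for some Möbius map $\phi$. *)

(* Defs.v *)
From mathcomp Require Import all_boot all_order all_algebra.
From mathcomp Require Export complex.
From mathcomp Require Export reals.
From mathcomp Require Import ring.

Set Implicit Arguments.
Unset Strict Implicit.
Unset Printing Implicit Defensive.

Import GRing.Theory.
Local Open Scope ring_scope.
Local Open Scope quotient_scope.

Notation "p %:F" := (FracField.tofrac p) : ring_scope.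

(* For K = C, [sphere K] is the extended complex plane; [None] is infinity. *)
Definition sphere (K : fieldType) : Type := option K.

(* Rational functions are elements of the field K(X); below, the map that
   such an element induces on the sphere is a separate notion, [ratmap]. *)
Notation ratfun K := {fraction {poly K}}.

Section RationalFunctions.
Variable K : fieldType.
Implicit Types (f : ratfun K) (n d : {poly K}).

(* [f] in lowest terms is [rnum f / rden f]. *)
Definition rgcd f : {poly K} := gcdp \n_(repr f) \d_(repr f).
Definition rnum f : {poly K} := \n_(repr f) %/ rgcd f.
Definition rden f : {poly K} := \d_(repr f) %/ rgcd f.

(* With [N] the larger of the two degrees, the value at infinity is the
   quotient of the coefficients of degree [N], or infinity if the one of the
   denominator vanishes. *)
Definition ratmap f (x : sphere K) : sphere K :=
  match x with
  | Some z => if (rden f).[z] == 0 then None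
              else Some ((rnum f).[z] / (rden f).[z])
  | None => let N := (maxn (size (rnum f)) (size (rden f))).-1 in
            if (rden f)`_N == 0 then None else Some ((rnum f)`_N / (rden f)`_N)
  end.

Definition rderiv f : ratfun K :=
  ((rnum f)^`() * rden f - rnum f * (rden f)^`())%:F / (rden f ^+ 2)%:F.

(* Meaningful when [rderiv f != 0]: division by zero is total here. *)
Definition newton f : ratfun K := 'X%:F - f / rderiv f.

Definition mobius (a b c d : K) (x : sphere K) : sphere K :=
  match x with
  | Some z => if c * z + d == 0 then None else Some ((a * z + b) / (c * z + d))
  | None => if c == 0 then None else Some (a / c)
  end.

Definition is_mobius (phi : sphere K -> sphere K) : Prop :=
  exists a b c d : K, a * d - b * c != 0 /\ phi =1 mobius a b c d.

Definition conformally_conjugate (f1 f2 : ratfun K) : Prop :=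
  exists phi phi_inv : sphere K -> sphere K,
    [/\ is_mobius phi, cancel phi phi_inv, cancel phi_inv phi
      & ratmap f1 =1 phi \o ratmap f2 \o phi_inv].

Lemma rgcd_neq0 f : rgcd f != 0.
Proof. by rewrite gcdp_eq0 negb_and denom_ratioP orbT. Qed.

Lemma rden_neq0 f : rden f != 0.
Proof. by rewrite dvdp_div_eq0 ?dvdp_gcdr // denom_ratioP. Qed.

Lemma coprimep_rnum_rden f : coprimep (rnum f) (rden f).
Proof. by apply: coprimep_div_gcd; rewrite denom_ratioP orbT. Qed.

Lemma ratio_divE (x : {ratio {poly K}}) :
  \pi_({fraction {poly K}}) x = (\n_x)%:F / (\d_x)%:F.
Proof.
have dx0 : (\d_x)%:F != 0 :> {fraction {poly K}}
  by rewrite tofrac_eq0 denom_ratioP.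
apply: (mulIf dx0); rewrite mulfVK //.
unlock FracField.tofrac; rewrite -[LHS]FracField.pi_mul.
apply/eqmodP; rewrite /= FracField.equivfE /FracField.mulf.
by rewrite !numden_Ratio ?oner_neq0 ?mulf_neq0 ?denom_ratioP ?oner_neq0 //
   !mulr1 mulrC.
Qed.

Lemma ratfunE f : f = (rnum f)%:F / (rden f)%:F.
Proof.
rewrite -[LHS]reprK ratio_divE.
rewrite -[\n_(repr f)](divpK (dvdp_gcdl _ \d_(repr f))).
rewrite -[X in _ / X%:F](divpK (dvdp_gcdr \n_(repr f) _)).
rewrite -/(rgcd f) -/(rnum f) -/(rden f) !tofracM.
by rewrite -mulf_div divff ?mulr1 // tofrac_eq0 rgcd_neq0.
Qed.

Lemma rnum_cross n d : d != 0 ->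
  let f : ratfun K := n%:F / d%:F in rnum f * d = n * rden f.
Proof.
move=> d0 f; apply/eqP; rewrite -tofrac_eq !tofracM -eqr_div ?tofrac_eq0 //.
  by rewrite -ratfunE.
exact: rden_neq0.
Qed.

Lemma rderivE n d : d != 0 ->
  rderiv (n%:F / d%:F) = (n^`() * d - n * d^`())%:F / (d ^+ 2)%:F.
Proof.
move=> d0; have := rnum_cross n d0; set f : ratfun K := _ / _ => /= E.
have f0 := rden_neq0 f.
have dE : (rnum f)^`() * d = n^`() * rden f + n * (rden f)^`() - rnum f * d^`().
  by apply/eqP; rewrite eq_sym subr_eq -!derivM E.
apply/eqP; rewrite eqr_div ?tofrac_eq0 ?expf_neq0 // -!tofracM tofrac_eq.
apply/eqP.
transitivity (rden f * d * ((rnum f)^`() * d)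
              - (rnum f * d) * d * (rden f)^`()); first by ring.
rewrite dE E.
transitivity (rden f * d * n^`() * rden f
              - rden f * (rnum f * d) * d^`()); first by ring.
by rewrite E; ring.
Qed.

Lemma ratmapE n d z : d.[z] != 0 ->
  ratmap (n%:F / d%:F) (Some z) = Some (n.[z] / d.[z]).
Proof.
move=> dz0; have d0 : d != 0 by apply: contraNneq dz0 => ->; rewrite horner0.
have := rnum_cross n d0; set f : ratfun K := _ / _ => /= E.
have Ez : (rnum f).[z] * d.[z] = n.[z] * (rden f).[z] by rewrite -!hornerM E.
have fz0 : (rden f).[z] != 0.
  apply/negP => r0; have rz0 : root (rnum f) z.
    by move: Ez; rewrite (eqP r0) mulr0 => /eqP; rewrite mulf_eq0 (negPf dz0) orbF.
  have := coprimep_root (coprimep_rnum_rden f) rz0.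
  by rewrite r0.
by rewrite (negPf fz0); congr Some; apply/eqP; rewrite eqr_div // Ez.
Qed.

End RationalFunctions.

(* Main.v *)
Require Import Defs.
From mathcomp Require Import all_boot all_order all_algebra.
From mathcomp Require Import ring.
Import Order.TTheory GRing.Theory Num.Theory.
Local Open Scope ring_scope.
Local Open Scope complex_scope.

(** Suppose that [phi] conjugates the polynomial [P] to the Newton map of [f],
where [phi w = (A w + B) / (C w + D)]. Put [F = f \o phi] and
[L = C w + D]. The chain rule turns the conjugacy into
[F' / F = 1 / (w - P) - C / L], that is, [G' / G = 1 / (w - P)] for
[G = F L]. So [P] is itself the Newton map of [G]: moving infinity to where
[P] has it only multiplies [f \o phi] by a linear factor
([dlog_of_newton_conj_poly]).

A logarithmic derivative has integer residues, so at every fixed point [w] of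
[P] one has [m (1 - P'(w)) = 1] for some integer [m] ([residue_dlog]); hence
[1 - P'(w)] is real and at least [-1], i.e. the multiplier is at most [2].

This is impossible for [P = a (w - alpha)^sigma + b] with [sigma >= 3]
([unicritical_fixpoint_multiplier]). With [u = w - alpha] and
[c = b - alpha], the fixed points are the roots of [a u^sigma - u + c], and
their multiplier [t = sigma a u^(sigma - 1)] satisfies
[u (sigma - t) = sigma c]. If all multipliers are at most [2], every
[sigma - t] is positive. If [c] is nonzero, every root [u] is thus a positive
multiple of [c], although the roots sum to zero because the coefficient of
[u^(sigma - 1)] vanishes. If [c = 0], every root would be zero, although
[a u^(sigma - 1) = 1] has a solution. *)

Set Implicit Arguments.
Unset Strict Implicit.
Unset Printing Implicit Defensive.

(** * Residues of logarithmic derivatives *)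

Lemma eq_poly_off_roots (K : closedFieldType) (d p q : {poly K}) :
  d != 0 -> (forall w, d.[w] != 0 -> p.[w] = q.[w]) -> p = q.
Proof.
move=> d0 pq; apply/eqP; rewrite -subr_eq0; apply/negPn/negP => pq0.
have /closed_nonrootP[w] : d * (p - q) != 0 by rewrite mulf_neq0.
rewrite rootE hornerM mulf_eq0 negb_or hornerD hornerN => /andP[dw].
by rewrite (pq _ dw) subrr eqxx.
Qed.

(** The hypothesis says that [u / v] has logarithmic derivative [1 / h]. Its
residue at [w] is the order of [u / v] there, and existence of that residue
forces [w] to be a simple root of [h] with residue [1 / h'(w)]. *)
Lemma residue_dlog (K : fieldType) (u v h : {poly K}) (w : K) :
    u != 0 -> v != 0 -> (u^`() * v - u * v^`()) * h = u * v -> root h w ->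
  exists m : int, m%:~R * h^`().[w] = 1.
Proof.
move=> u0 v0 E /factor_theorem[k hE].
have [i [u1 ru1 uE]] := multiplicity_XsubC u w.
have [j [v1 rv1 vE]] := multiplicity_XsubC v w.
rewrite u0 /= in ru1; rewrite v0 /= in rv1.
(* Logarithmic differentiation of [t (X - w)^n], multiplied by [X - w] so that
   no predecessor of [n] appears. *)
have dexp n (t : {poly K}) : (t * ('X - w%:P) ^+ n)^`() * ('X - w%:P)
     = (t^`() * ('X - w%:P) + n%:R * t) * ('X - w%:P) ^+ n.
  rewrite derivM deriv_exp derivXsubC mul1r mulrDl -mulrA mulrCA.
  case: n => [|n]; first by rewrite /=; ring.
  by rewrite -mulr_natl /= exprS; ring.
have dh : h^`().[w] = k.[w].
  by rewrite hE derivM derivXsubC !hornerE subrr mulr0 add0r.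
exists (i%:Z - j%:Z); rewrite dh.
have X0 : ('X - w%:P) ^+ (i + j) != 0 by rewrite expf_neq0 // polyXsubC_eq0.
have E1 : ((u1^`() * ('X - w%:P) + i%:R * u1) * v1
          - u1 * (v1^`() * ('X - w%:P) + j%:R * v1)) * k = u1 * v1.
  apply: (mulIf X0); rewrite exprD.
  transitivity (u * v); last by rewrite uE vE; ring.
  rewrite -E hE.
  transitivity (((u1^`() * ('X - w%:P) + i%:R * u1) * ('X - w%:P) ^+ i * v
          - u * ((v1^`() * ('X - w%:P) + j%:R * v1) * ('X - w%:P) ^+ j)) * k).
    by rewrite uE vE; ring.
  by rewrite -!dexp -uE -vE; ring.
have uv0 : u1.[w] * v1.[w] != 0 by rewrite mulf_neq0.
apply: (mulfI uv0); rewrite mulr1 -{2}hornerM -E1 !hornerE /=.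
rewrite -!polyC_natr !hornerC intrB.
by ring.
Qed.

(** The order on a [numFieldType] may be partial (as on the complex numbers),
so the conclusion also says that [x] is real. *)
Lemma inv_int_geN1 (K : numFieldType) (m : int) (x : K) :
  m%:~R * x = 1 -> -1 <= x.
Proof.
move=> mx; have m0 : m%:~R != 0 :> K.
  by apply/eqP => m0; move/eqP: mx; rewrite m0 mul0r eq_sym oner_eq0.
have -> : x = m%:~R^-1 by apply: (mulfI m0); rewrite mx mulfV.
case: m {mx m0} => n.
  by apply: (@le_trans _ _ 0); rewrite ?lerN10 // invr_ge0 ler0n.
by rewrite NegzE mulrNz invrN lerN2 invf_le1 ?ltr0n // ler1n.
Qed.

(** * Pulling polynomials back along a Moebius map *)

Section Pullback.
Variables (K : fieldType) (A B C D : K).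

(** [u] is the numerator of [p \o phi] over the denominator [l ^+ N]. The second
equation is the chain rule for [u = l ^+ N * (p \o phi)], with
[phi' = (A D - B C) / l ^+ 2]; carrying it along makes it enough to check it on
generators, so that [p \o phi] never has to be differentiated as a rational
function. *)
Definition is_pullback (p : {poly K}) (N : nat) (u : {poly K}) :=
  forall w, let l := C * w + D in l != 0 ->
  let z := (A * w + B) / l in
  u.[w] = l ^+ N * p.[z] /\
  l ^+ 2 * u^`().[w] =
    (A * D - B * C) * l ^+ N * p^`().[z] + N%:R * C * l * u.[w].

Lemma pullbackC c : is_pullback c%:P 0 c%:P.
Proof. by move=> w l l0 z; rewrite !derivC !hornerC; split; ring. Qed.

(** Multiplying by this pullback of the constant [1] raises the exponent [N]
without changing [p]. *)
Lemma pullback_den : is_pullback 1 1 (C *: 'X + D%:P).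
Proof.
move=> w l l0 z; rewrite -polyC1 !derivE !hornerE -/l.
by split; ring.
Qed.

Lemma pullbackX : is_pullback 'X 1 (A *: 'X + B%:P).
Proof.
move=> w l l0 z; rewrite !derivE !hornerE.
split; first by rewrite expr1 /= [l * _]mulrC mulfK.
by rewrite /l; ring.
Qed.

Lemma pullbackD p q N u v : is_pullback p N u -> is_pullback q N v ->
  is_pullback (p + q) N (u + v).
Proof.
move=> Hp Hq w l l0 z; have [Hu Hu'] := Hp w l0; have [Hv Hv'] := Hq w l0.
rewrite !derivD !hornerD; split; first by rewrite Hu Hv mulrDr.
by rewrite mulrDr Hu' Hv' -/l -/z; ring.
Qed.

Lemma pullbackM p q N M u v : is_pullback p N u -> is_pullback q M v ->
  is_pullback (p * q) (N + M) (u * v).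
Proof.
move=> Hp Hq w l l0 z; have [Hu Hu'] := Hp w l0; have [Hv Hv'] := Hq w l0.
rewrite !derivM !hornerD !hornerM; split; first
  by rewrite Hu Hv -/l -/z exprD; ring.
transitivity ((l ^+ 2 * u^`().[w]) * v.[w] + u.[w] * (l ^+ 2 * v^`().[w])).
  by ring.
rewrite Hu' Hv' -/l -/z.
transitivity ((A * D - B * C) * l ^+ N * p^`().[z] * v.[w] +
  (A * D - B * C) * l ^+ M * q^`().[z] * u.[w]
  + (N + M)%:R * C * l * (u.[w] * v.[w])); first by rewrite natrD; ring.
by congr (_ + _); rewrite Hu Hv -/l -/z exprD; ring.
Qed.

End Pullback.

(** Splitting [p] into linear factors makes [u != 0] immediate: the factor of a
root [r] pulls back to [(A - r C) X + (B - r D)], which is nonzero because the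
determinant is. *)
Lemma pullback_exists (K : closedFieldType) (A B C D : K) (p : {poly K}) :
    A * D - B * C != 0 -> p != 0 ->
  exists N u, u != 0 /\ is_pullback A B C D p N u.
Proof.
move=> Delta0 p0; have [rs ->] := closed_field_poly_normal p.
rewrite -mul_polyC.
elim: rs => [|r rs [N [u [u0 Hu]]]].
  exists 0, (lead_coef p)%:P; rewrite big_nil mulr1.
  by rewrite polyC_eq0 lead_coef_eq0; split=> //; apply: pullbackC.
exists (1 + N)%N, ((A *: 'X + B%:P + (- r)%:P * (C *: 'X + D%:P)) * u).
split.
  rewrite mulf_neq0 //; apply: contra_neq Delta0 => /polyP E.
  have := E 0%N; have := E 1%N.
  rewrite !(coefD, coefCM, coefZ, coefX, coefC, coef0) /=.
  rewrite !(mulr0, mulr1, addr0, add0r).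
  move=> /eqP; rewrite mulNr subr_eq0 => /eqP->.
  by move=> /eqP; rewrite mulNr subr_eq0 => /eqP->; ring.
rewrite big_cons mulrCA; apply: pullbackM => //.
rewrite -polyCN; apply: pullbackD; first exact: pullbackX.
rewrite -[(- r)%:P in X in is_pullback _ _ _ _ X]mulr1.
apply: (@pullbackM _ _ _ _ _ _ _ 0); [exact: pullbackC | exact: pullback_den].
Qed.

Lemma pullback_raise (K : fieldType) (A B C D : K) (p u : {poly K}) (N M : nat) :
  is_pullback A B C D p N u ->
  is_pullback A B C D p (N + M) (u * (C *: 'X + D%:P) ^+ M).
Proof.
move=> Hu; elim: M => [|M IHM]; first by rewrite addn0 mulr1.
rewrite addnS -addn1 exprSr mulrA -[p]mulr1.
by apply: pullbackM => //; apply: pullback_den.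
Qed.

(** * The conjugated Newton map as a Newton map *)

Lemma newtonE (K : fieldType) (f : ratfun K) :
    let n := rnum f in let d := rden f in
    let g := n^`() * d - n * d^`() in
  g != 0 -> newton f = ('X * g - n * d)%:F / g%:F.
Proof.
move=> n d g g0; have d0 : d != 0 by exact: rden_neq0.
rewrite /newton {1}[f]ratfunE /rderiv -/n -/d -/g.
have gF : g%:F != 0 :> ratfun K by rewrite tofrac_eq0.
have dF : d%:F != 0 :> ratfun K by rewrite tofrac_eq0.
(* Stated in an abstract field so that [field] does not have to compute in the
   fraction field. *)
have E (F : fieldType) (x y z t : F) : z != 0 -> t != 0 ->
    x - y / z / (t / z ^+ 2) = (x * t - y * z) / t.
  by move=> z0 t0; field; apply/andP.
have {E} := E _ 'X%:F n%:F d%:F g%:F dF gF.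
rewrite expr2 -2!tofracM -tofracM -tofracB => <-.
by rewrite -expr2.
Qed.

(** The rational function [u / v] found here is [G = (f \o phi) * (C X + D)].
Thanks to the linear factor the equation has the same form at the pole of
[phi], which corresponds to infinity for [f], as at every other point. *)
Lemma dlog_of_newton_conj_poly (K : closedFieldType) (f : ratfun K) (P : {poly K}) :
    (1 < size P)%N -> rderiv f != 0 ->
    conformally_conjugate (newton f) P%:F ->
  exists u v : {poly K}, [/\ u != 0, v != 0
    & (u^`() * v - u * v^`()) * ('X - P) = u * v].
Proof.
move=> sP df0 [phi [psi [[A [B [C [D [Delta0 phiE]]]]] phiK _ conj]]].
pose p := rnum f; pose q := rden f; pose g := p^`() * q - p * q^`().
have q0 : q != 0 by exact: rden_neq0.
have g0 : g != 0.
  by apply: contraNneq df0 => g0; rewrite /rderiv -/p -/q -/g g0 tofrac0 mul0r.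
have p0 : p != 0.
  by apply: contra_neq g0 => p0; rewrite /g p0 deriv0 !mul0r subrr.
have NE : newton f = ('X * g - p * q)%:F / g%:F by exact: newtonE.
have gE x : g.[x] = p^`().[x] * q.[x] - p.[x] * q^`().[x].
  by rewrite hornerD hornerN !hornerM.
pose l : {poly K} := C *: 'X + D%:P.
have lE w : l.[w] = C * w + D by rewrite !hornerE.
have dlE : l^`() = C%:P by rewrite !derivE alg_polyC addr0.
have CD : (C != 0) || (D != 0).
  rewrite -negb_and; apply/negP => /andP[/eqP C0 /eqP D0].
  by move: Delta0; rewrite C0 D0 !mulr0 subrr eqxx.
have l0 : l != 0.
  apply/eqP => /polyP E; have := E 0%N; have := E 1%N.
  rewrite !(coefD, coefCM, coefZ, coefX, coefC, coef0) /= !mulr0 mulr1 addr0 add0r.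
  by move=> C0 D0; move: CD; rewrite C0 D0 eqxx.
pose lP : {poly K} := C *: P + D%:P.
have lPE w : lP.[w] = C * P.[w] + D by rewrite !hornerE.
have lP0 : lP != 0.
  have [C0|C0] := eqVneq C 0.
    by move: CD; rewrite C0 eqxx /= /lP C0 scale0r add0r polyC_eq0.
  rewrite -size_poly_gt0 size_polyDl; first by rewrite size_scale // ltnW.
  by rewrite size_scale // (leq_ltn_trans (size_polyC_leq1 _)).
have [N [u0 [u00 Hu0]]] := pullback_exists Delta0 p0.
have [M [v0 [v00 Hv0]]] := pullback_exists Delta0 q0.
have [G [gt [gt0 Hg]]] := pullback_exists Delta0 g0.
(* A common denominator for the pullbacks of [p] and [q], so that it cancels
   in [u / v]. *)
have Hu := pullback_raise M Hu0.
have Hv := pullback_raise N Hv0.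
rewrite [(M + N)%N]addnC -/l in Hu Hv.
have : u0 * l ^+ M != 0 by rewrite mulf_neq0 ?expf_neq0.
have : v0 * l ^+ N != 0 by rewrite mulf_neq0 ?expf_neq0.
move: (u0 * _) (v0 * _) Hu Hv => u v Hu Hv vn0 un0.
clearbody p q g l lP.
exists (u * l), v; split; rewrite ?mulf_neq0 //.
(* Off the roots of this product, [w], [P w] and the Newton map at [phi w] are
   all computed by their finite formulas. *)
apply: (@eq_poly_off_roots _ (l * lP * gt)); first by rewrite !mulf_neq0.
move=> w; rewrite !hornerM !mulf_eq0 !negb_or lE lPE => /andP[/andP[lw lPw] gw].
have [uE u'E] := Hu w lw; have [vE v'E] := Hv w lw; have [gtE _] := Hg w lw.
set z := _ / _ in uE u'E vE v'E gtE.
have gz : g.[z] != 0 by apply: contra_neq gw => gz; rewrite gtE gz mulr0.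
have phiw : phi (Some w) = Some z by rewrite phiE /= (negPf lw).
have := conj (phi (Some w)).
rewrite /= phiK phiw NE ratmapE //.
rewrite -[P%:F]divr1 -tofrac1 ratmapE; last by rewrite hornerC oner_neq0.
rewrite hornerC divr1 phiE /= (negPf lPw) => -[].
rewrite hornerD hornerN !hornerM hornerX => E.
have E1 : (A * D - B * C) * (w - P.[w]) * g.[z] =
          p.[z] * q.[z] * (C * w + D) * (C * P.[w] + D).
  have {}E : z - p.[z] * q.[z] / g.[z] = (A * P.[w] + B) / (C * P.[w] + D).
    by rewrite -E; field.
  have {}E : p.[z] * q.[z] / g.[z] = z - (A * P.[w] + B) / (C * P.[w] + D).
    by rewrite -E; ring.
  rewrite -[p.[z] * q.[z]](@divfK _ g.[z]) // E /z.
  by field; apply/andP.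
have L2 : (C * w + D) ^+ 2 != 0 by rewrite expf_neq0.
(* The wronskian of [u] and [v] is that of [p] and [q] pulled back: the terms
   coming from the common denominator cancel. *)
have wr : (C * w + D) ^+ 2 * (u^`().[w] * v.[w] - u.[w] * v^`().[w])
    = (A * D - B * C) * (C * w + D) ^+ (N + M) ^+ 2 * g.[z].
  transitivity (((C * w + D) ^+ 2 * u^`().[w]) * v.[w]
     - u.[w] * ((C * w + D) ^+ 2 * v^`().[w])); first by ring.
  rewrite u'E v'E uE vE gE.
  by ring.
rewrite derivM !(hornerD, hornerN, hornerM) hornerX dlE hornerC lE.
apply: (mulfI L2).
transitivity (((C * w + D) ^+ 2 * (u^`().[w] * v.[w] - u.[w] * v^`().[w]))
     * (C * w + D) * (w - P.[w])
   + (C * w + D) ^+ 2 * C * u.[w] * v.[w] * (w - P.[w])); first by ring.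
rewrite wr.
transitivity (((C * w + D) ^+ (N + M)) ^+ 2 * (C * w + D) *
    ((A * D - B * C) * (w - P.[w]) * g.[z])
   + (C * w + D) ^+ 2 * C * u.[w] * v.[w] * (w - P.[w])); first by ring.
rewrite E1 uE vE; ring.
Qed.

(** * Fixed points of unicritical polynomials *)

(** At some fixed point the multiplier is not a real number at most [2]. If all
were, the displacements [u] of the fixed points from the critical point would
be positive multiples of one number, yet they sum to zero since
[sigma >= 3], and they are not all zero. *)
Lemma unicritical_fixpoint_multiplier (K : numClosedFieldType)
    (a alpha b : K) (sigma : nat) :
    let P := a *: ('X - alpha%:P) ^+ sigma + b%:P in
    a != 0 -> (3 <= sigma)%N ->
  exists w, root ('X - P) w /\ ~ -1 <= ('X - P)^`().[w].
Proof.
move=> P a0 s3; pose c := b - alpha.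
(* [a Q(u)] is [P - X] at [alpha + u], so [Q] is the monic equation of the
   fixed points, centred at the critical point. *)
pose Q : {poly K} := 'X^sigma + (- a^-1 *: 'X + (c / a)%:P).
have sLow : (size (- a^-1 *: 'X + (c / a)%:P)%R < sigma.+1)%N.
  apply: (leq_ltn_trans (size_polyD _ _)); rewrite gtn_max ltnS.
  rewrite (leq_trans (size_scale_leq _ _)) ?size_polyX ?(ltnW s3) //=.
  by rewrite (leq_ltn_trans (size_polyC_leq1 _)) // ltnS ltnW // ltnW.
have Qsize : size Q = sigma.+1 by rewrite size_polyDl size_polyXn.
have Qlead : lead_coef Q = 1 by rewrite lead_coefDl ?size_polyXn // lead_coefXn.
have [us QE] := closed_field_poly_normal Q.
rewrite Qlead scale1r in QE.
have us_size : size us = sigma.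
  by apply: succn_inj; rewrite -Qsize QE size_prod_XsubC.
have us_sum : \sum_(u <- us) u = 0.
  apply: oppr_inj; rewrite oppr0 -coefPn_prod_XsubC us_size;
    last by rewrite -lt0n (ltn_trans _ s3).
  rewrite -QE !(coefD, coefZ, coefX, coefC, coefXn).
  have [n ->] : exists n, sigma = n.+3 by exists (sigma - 3)%N; rewrite -addn3 subnK.
  by rewrite /= ltn_eqF // mulr0 !addr0.
have P'E w : ('X - P)^`().[w] = 1 - sigma%:R * a * (w - alpha) ^+ sigma.-1.
  rewrite !derivE deriv_exp derivXsubC !hornerE /=.
  by rewrite hornerMn horner_exp !hornerE -mulr_natl; ring.
have QrootE u : root Q u -> a * u ^+ sigma = u - c.
  rewrite rootE /Q hornerD hornerXn hornerD hornerZ hornerX hornerC => /eqP E.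
  have -> : a * u ^+ sigma = a * (u ^+ sigma + (- a^-1 * u + c / a)) + (u - c).
    by field.
  by rewrite E mulr0 add0r.
have Qfix u : root Q u -> root ('X - P) (alpha + u).
  move=> /QrootE E; rewrite rootE /P hornerD hornerX hornerN hornerD hornerZ.
  rewrite horner_exp hornerXsubC hornerC [alpha + u]addrC addrK E /c.
  by apply/eqP; ring.
have Qmult u : root Q u ->
    u * (sigma%:R - 1 + ('X - P)^`().[alpha + u]) = sigma%:R * c.
  move=> /QrootE E; rewrite P'E [alpha + u]addrC addrK.
  transitivity (sigma%:R * (u - a * (u * u ^+ sigma.-1))); first by ring.
  by rewrite -exprS prednK ?(ltnW (ltnW s3)) // E; ring.
have mem_us u : (u \in us) = root Q u by rewrite QE root_prod_XsubC.
have [/hasP[u uus bad]|/hasPn good] :=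
    boolP (has (fun u => ~~ (-1 <= ('X - P)^`().[alpha + u])) us).
  by exists (alpha + u); split; [apply: Qfix; rewrite -mem_us | exact/negP].
have t_gt0 u : u \in us -> 0 < sigma%:R - 1 + ('X - P)^`().[alpha + u].
  move=> /good; rewrite negbK => ge.
  apply: (@lt_le_trans _ _ (sigma%:R - 1 - 1)); last by rewrite lerD2l.
  by rewrite -addrA -opprD -[1 + 1]/(2%:R) subr_gt0 ltr_nat.
have [c0|c0] := eqVneq c 0.
  (* With [c = 0] the critical point is fixed and the other fixed points have
     multiplier [sigma]. *)
  pose u := sigma.-1.-root a^-1.
  have uE : u ^+ sigma.-1 = a^-1 by rewrite rootCK // -ltnS prednK // ltnW // ltnW.
  have u0 : u != 0.
    apply: contra_neq a0 => u0; apply: invr_inj; rewrite invr0 -uE u0 expr0n.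
    by rewrite -subn1 subn_eq0 leqNgt ltnW.
  have uus : u \in us.
    rewrite mem_us rootE /Q hornerD hornerXn hornerD hornerZ hornerX hornerC.
    rewrite c0 mul0r addr0 -(@prednK sigma) ?(ltnW (ltnW s3)) // exprS uE.
    by apply/eqP; ring.
  have := Qmult u; rewrite -mem_us c0 mulr0 => /(_ uus) /eqP.
  by rewrite mulf_eq0 (negPf u0) gt_eqF // t_gt0.
have pos u : u \in us -> 0 < u / c.
  move=> uus; have t0 := t_gt0 u uus.
  have := Qmult u; rewrite -mem_us => /(_ uus) E.
  have -> : u / c = sigma%:R / (sigma%:R - 1 + ('X - P)^`().[alpha + u]).
    apply: (mulIf c0); rewrite divfK // mulrAC -E mulfK //; exact: lt0r_neq0.
  by rewrite divr_gt0 // ltr0n ltnW // ltnW.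
have : \sum_(u <- us | u \in us) u / c == 0.
  by rewrite -big_seq -mulr_suml us_sum mul0r.
rewrite psumr_eq0 => [|u /pos/ltW //].
case: us us_size pos {QE us_sum mem_us good t_gt0} => [|u us] /= us_size pos.
  by rewrite -us_size in s3.
by rewrite mem_head gt_eqF // pos ?mem_head.
Qed.

Theorem theorem4p1 (R : realType) :
  ~ exists f : ratfun R[i],
      rderiv f != 0 /\
      exists (a alpha b : R[i]) (sigma : nat),
        [/\ a != 0, (3 <= sigma)%N
          & conformally_conjugate (newton f)
              (a *: ('X - alpha%:P) ^+ sigma + b%:P)%:F].
Proof.
case=> f [f'0 [a [alpha [b [sigma [a0 s3 conj]]]]]].
have [w [Pw]] := unicritical_fixpoint_multiplier alpha b a0 s3; apply.
have sP : (1 < size (a *: ('X - alpha%:P) ^+ sigma + b%:P)%R)%N.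
  have sX : size (a *: ('X - alpha%:P) ^+ sigma) = sigma.+1.
    by rewrite size_scale // size_exp_XsubC.
  have sb : (size b%:P < sigma.+1)%N.
    by rewrite (leq_ltn_trans (size_polyC_leq1 _)) // ltnS ltnW // ltnW.
  by rewrite size_polyDl sX // ltnS ltnW // ltnW.
have [u [v [u0 v0 E]]] := dlog_of_newton_conj_poly sP f'0 conj.
have [m mE] := residue_dlog u0 v0 E Pw.
exact: inv_int_geN1 mE.
Qed.
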